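(* There exist relational schemas $\mathcal{D},\mathcal{Q}$ and a first-order rewritable OCQA ontology $O$ over $(\mathcal{D},\mathcal{Q})$ that cannot be defined by any finite set of embedded dependencies (EDs); that is, there are no relational schema $\mathcal{R}\supseteq\mathcal{D}\cup\mathcal{Q}$ and finite set $\Sigma$ of EDs over $\mathcal{R}$ with $O=Sem(\Sigma,\mathcal{D},\mathcal{Q})$.
   Context: Databases. Fix infinite disjoint sets of constants and variables; terms are constants or variables. A relational schema is a set of relation symbols with arities (arity $0$ allowed). A fact is a variable-free relation atom; an instance over $\mathcal{R}$ is a (possibly infinite) set of facts over $\mathcal{R}$; a database is a finite instance. $adom(I)$ is the set of constants occurring in $I$. An instance is regarded as a structure with domain $adom(I)$, constants denoting themselves. For databases $D,D'$ and $C\subseteq adom(D)\cap adom(D')$, write $D\Rightarrow_C D'$ if there is an injective $h:adom(D)\to adom(D')$ with $h(c)=c$ for all $c\in C$ and such that $R(\vec a)\in D$ implies $R(h(\vec a))\in D'$ for every relation symbol $R$. Queries. A boolean conjunctive query (BCQ) over $\mathcal{Q}$ is a sentence $\exists\vec y\,\varphi(\vec y)$ with $\varphi$ a nonempty conjunction of relation atoms over $\mathcal{Q}$ (constants allowed). $const(q)$ is the set of constants occurring in $q$. Dependencies. An embedded dependency (ED) over $\mathcal{R}$ is a first-order sentence $\forall\vec x\forall\vec y\,(\phi(\vec x,\vec y)\to\exists\vec z.\psi(\vec x,\vec z))$, where $\phi$ is a (possibly empty) conjunction of relation atoms over $\mathcal{R}$ with terms among the variables $\vec x,\vec y$, $\psi$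 is a conjunction of atoms over $\mathcal{R}$ (relation atoms or equalities) with terms among the variables $\vec x,\vec z$, and every variable of $\vec x$ occurs in $\phi$. For a database $D$, a set $\Sigma$ of such sentences and a BCQ $q$ over $\mathcal{R}$, write $D\cup\Sigma\models q$ if every instance $I$ over $\mathcal{R}$ with $D\subseteq I$ and $I\models\Sigma$ satisfies $q$. $Sem(\Sigma,\mathcal{D},\mathcal{Q})$ is the set of pairs $(D,q)$ with $D$ a database over $\mathcal{D}$, $q$ a BCQ over $\mathcal{Q}$ with $const(q)\subseteq adom(D)$, and $D\cup\Sigma\models q$. Ontologies. An OCQA ontology over $(\mathcal{D},\mathcal{Q})$ is a set $O$ of pairs $(D,q)$, with $D$ a database over $\mathcal{D}$ and $q$ a BCQ over $\mathcal{Q}$ such that $const(q)\subseteq adom(D)$, satisfying: (1) $(D,q),(D,q')\in O$ implies $(D,q\wedge q')\in O$; (2) $q\models q'$ and $(D,q)\in O$ imply $(D,q')\in O$; (3) $D\Rightarrow_C D'$ and $(D,q)\in O$, where $C=const(q)$, imply $(D',q)\in O$. $O$ is first-order rewritable if for every BCQ $q$ over $\mathcal{Q}$ there is a first-order sentence $q_O$ such that for all databases $D$ over $\mathcal{D}$ with $const(q)\subseteq adom(D)$: $(D,q)\in O$ iff $D\models q_O$. *)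

(* Defs.v *)
From mathcomp Require Import all_boot.
From mathcomp Require Import boolp classical_sets functions cardinality.
Set Implicit Arguments.
Unset Strict Implicit.
Unset Printing Implicit Defensive.

Local Open Scope classical_set_scope.

(* The type C of constants is a parameter throughout (the final result assumes
   it infinite); variables are natural numbers. *)
Definition var := nat.

Inductive term (C : choiceType) : Type :=
| Cst of C
| Var of var.
Arguments Var {C} _.

(* A relation symbol is a pair (name, arity), so that there are infinitely many
   symbols of every arity; a schema is an arbitrary set of symbols. *)
Definition relsym := (nat * nat)%type.
Definition arity (r : relsym) : nat := r.2.
Definition schema := set relsym.

(* Relation atoms R(t_1, ..., t_n) with arguments in T: facts for T = C, atoms
   of formulas for T = term C, constant-free atoms for T = var. *)
Record ratom (T : Type) : Type := RAtom {
  rsym : relsym;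
  rargs : (arity rsym).-tuple T
}.

Definition map_ratom (T U : Type) (f : T -> U) (a : ratom T) : ratom U :=
  RAtom (map_tuple f (rargs a)).

Definition term_vars (C : choiceType) (t : term C) : seq var :=
  if t is Var x then [:: x] else [::].

Definition term_csts (C : choiceType) (t : term C) : seq C :=
  if t is Cst c then [:: c] else [::].

Definition atom_vars (C : choiceType) (a : ratom (term C)) : seq var :=
  flatten (map (@term_vars C) (rargs a)).

Definition atom_csts (C : choiceType) (a : ratom (term C)) : seq C :=
  flatten (map (@term_csts C) (rargs a)).

Definition instance (C : choiceType) := set (ratom C).

Definition instance_over (C : choiceType) (R : schema) (I : instance C)
    : Prop :=
  forall a, I a -> R (rsym a).

Definition database (C : choiceType) (R : schema) (D : instance C) : Prop :=
  instance_over R D /\ finite_set D.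

Definition adom (C : choiceType) (I : instance C) : set C :=
  [set c | exists2 a, I a & c \in tval (rargs a)].

(* D =>_K D', for K included in the active domains of D and D'. The map h is
   total on constants, but only its values on [adom D] matter. *)
Definition db_embeds (C : choiceType) (K : set C) (D D' : instance C) : Prop :=
  exists h : C -> C,
    [/\ set_inj (adom D) h,
        h @` adom D `<=` adom D',
        forall c, K c -> h c = c
      & forall a, D a -> D' (map_ratom h a)].

Inductive formula (C : choiceType) : Type :=
| FTrue
| FFalse
| FRel of ratom (term C)
| FEq of term C & term C
| FNot of formula C
| FAnd of formula C & formula C
| FOr of formula C & formula C
| FImp of formula C & formula C
| FAll of var & formula C
| FEx of var & formula C.
Arguments FTrue {C}.
Arguments FFalse {C}.

Fixpoint free_vars (C : choiceType) (f : formula C) : seq var :=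
  match f with
  | FTrue | FFalse => [::]
  | FRel a => atom_vars a
  | FEq t u => term_vars t ++ term_vars u
  | FNot g => free_vars g
  | FAnd g k | FOr g k | FImp g k => free_vars g ++ free_vars k
  | FAll x g | FEx x g => [seq y <- free_vars g | y != x]
  end.

Definition sentence (C : choiceType) (f : formula C) : Prop :=
  free_vars f = [::].

Fixpoint formula_csts (C : choiceType) (f : formula C) : seq C :=
  match f with
  | FTrue | FFalse => [::]
  | FRel a => atom_csts a
  | FEq t u => term_csts t ++ term_csts u
  | FNot g => formula_csts g
  | FAnd g k | FOr g k | FImp g k => formula_csts g ++ formula_csts k
  | FAll _ g | FEx _ g => formula_csts g
  end.

Fixpoint formula_over (C : choiceType) (R : schema) (f : formula C) : Prop :=
  match f with
  | FTrue | FFalse | FEq _ _ => True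
  | FRel a => R (rsym a)
  | FNot g => formula_over R g
  | FAnd g k | FOr g k | FImp g k => formula_over R g /\ formula_over R k
  | FAll _ g | FEx _ g => formula_over R g
  end.

Definition valuation (C : choiceType) := var -> C.

Definition update (C : choiceType) (v : valuation C) (x : var) (c : C)
    : valuation C :=
  fun y => if y == x then c else v y.

Definition eval (C : choiceType) (v : valuation C) (t : term C) : C :=
  match t with Cst c => c | Var x => v x end.

(* Quantifiers range over the active domain of I, which may be empty. *)
Fixpoint sat (C : choiceType) (I : instance C) (v : valuation C) (f : formula C)
    : Prop :=
  match f with
  | FTrue => True
  | FFalse => False
  | FRel a => I (map_ratom (eval v) a)
  | FEq t u => eval v t = eval v u
  | FNot g => ~ sat I v g
  | FAnd g k => sat I v g /\ sat I v k
  | FOr g k => sat I v g \/ sat I v k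
  | FImp g k => sat I v g -> sat I v k
  | FAll x g => forall c, adom I c -> sat I (update v x c) g
  | FEx x g => exists2 c, adom I c & sat I (update v x c) g
  end.

(* Only used for sentences, whose truth does not depend on v. *)
Definition models (C : choiceType) (I : instance C) (f : formula C) : Prop :=
  forall v : valuation C, sat I v f.

Definition big_and (C : choiceType) (s : seq (formula C)) : formula C :=
  foldr (@FAnd C) FTrue s.

Definition all_vars (C : choiceType) (xs : seq var) (f : formula C)
    : formula C :=
  foldr (@FAll C) f xs.

Definition ex_vars (C : choiceType) (xs : seq var) (f : formula C)
    : formula C :=
  foldr (@FEx C) f xs.

(* A query is given by its nonempty list of atoms; the quantified variables are
   exactly those that occur in the atoms. *)
Record bcq (C : choiceType) : Type := BCQ {
  bcq_atoms : seq (ratom (term C));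
  bcq_nonempty : 0 < size bcq_atoms
}.

Definition bcq_vars (C : choiceType) (q : bcq C) : seq var :=
  undup (flatten (map (@atom_vars C) (bcq_atoms q))).

Definition bcq_csts (C : choiceType) (q : bcq C) : set C :=
  [set` flatten (map (@atom_csts C) (bcq_atoms q))].

Definition bcq_formula (C : choiceType) (q : bcq C) : formula C :=
  ex_vars (bcq_vars q) (big_and (map (@FRel C) (bcq_atoms q))).

Definition bcq_over (C : choiceType) (R : schema) (q : bcq C) : Prop :=
  formula_over R (bcq_formula q).

Definition bcq_entails (C : choiceType) (q q' : bcq C) : Prop :=
  forall I : instance C, models I (bcq_formula q) -> models I (bcq_formula q').

(* The conjunction of two queries as a query: the variables of the second one
   are shifted above those of the first one. *)
Definition shift_term (C : choiceType) (k : nat) (t : term C) : term C :=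
  match t with Cst c => Cst c | Var x => Var (k + x) end.

Lemma bcq_and_subproof (C : choiceType) (q : bcq C) (s : seq (ratom (term C))) :
  0 < size (bcq_atoms q ++ s).
Proof. by rewrite size_cat addn_gt0 bcq_nonempty. Qed.

Definition bcq_and (C : choiceType) (q q' : bcq C) : bcq C :=
  let k := (\max_(x <- bcq_vars q) x).+1 in
  BCQ (bcq_and_subproof q
         (map (map_ratom (@shift_term C k)) (bcq_atoms q'))).

(* Atoms of the head of a dependency: relation atoms or equalities, with
   variables as only terms. *)
Definition head_atom := (ratom var + var * var)%type.

Definition head_atom_vars (a : head_atom) : seq var :=
  match a with inl r => rargs r | inr (x, y) => [:: x; y] end.

Definition body_formula (C : choiceType) (a : ratom var) : formula C :=
  FRel (map_ratom Var a).

Definition head_formula (C : choiceType) (a : head_atom) : formula C :=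
  match a with
  | inl r => FRel (map_ratom Var r)
  | inr (x, y) => FEq (Var x) (Var y)
  end.

Definition is_ed (C : choiceType) (R : schema) (f : formula C) : Prop :=
  exists (xs ys zs : seq var) (phi : seq (ratom var)) (psi : seq head_atom),
    let body_vars := flatten (map (fun a => tval (rargs a)) phi) in
    let head_vars := flatten (map head_atom_vars psi) in
    [/\ uniq (xs ++ ys ++ zs),
        {subset body_vars <= xs ++ ys},
        0 < size psi /\ {subset head_vars <= xs ++ zs},
        {subset xs <= body_vars}
      & formula_over R f /\
        f = all_vars xs (all_vars ys
              (FImp (big_and (map (@body_formula C) phi))
                    (ex_vars zs (big_and (map (@head_formula C) psi)))))].

Definition entails (C : choiceType) (R : schema) (D : instance C)
    (Sigma : set (formula C)) (q : bcq C) : Prop :=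
  forall I : instance C, instance_over R I -> D `<=` I ->
    (forall s, Sigma s -> models I s) -> models I (bcq_formula q).

Definition admissible (C : choiceType) (DS QS : schema) (D : instance C)
    (q : bcq C) : Prop :=
  [/\ database DS D, bcq_over QS q & bcq_csts q `<=` adom D].

Definition Sem (C : choiceType) (R : schema) (Sigma : set (formula C))
    (DS QS : schema) : set (instance C * bcq C) :=
  [set p | admissible DS QS p.1 p.2 /\ entails R p.1 Sigma p.2].

Record ocqa_ontology (C : choiceType) (DS QS : schema)
    (O : set (instance C * bcq C)) : Prop := OcqaOntology {
  ocqa_admissible : forall D q, O (D, q) -> admissible DS QS D q;
  ocqa_and : forall D q q', O (D, q) -> O (D, q') -> O (D, bcq_and q q');
  ocqa_entails : forall D q q', bcq_over QS q' -> bcq_entails q q' ->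
    O (D, q) -> O (D, q');
  ocqa_embeds : forall D D' q, database DS D' ->
    db_embeds (bcq_csts q) D D' -> O (D, q) -> O (D', q)
}.

(* The constants of the rewriting are among those of q: only these are sure to
   belong to the active domain of every database considered. *)
Definition fo_rewritable (C : choiceType) (DS QS : schema)
    (O : set (instance C * bcq C)) : Prop :=
  forall q : bcq C, bcq_over QS q ->
    exists qO : formula C,
      [/\ sentence qO,
          formula_over DS qO,
          [set` formula_csts qO] `<=` bcq_csts q
        & forall D : instance C, database DS D -> bcq_csts q `<=` adom D ->
            (O (D, q) <-> models D qO)].

(* Main.v *)
(* Let O contain (D, q) when D has at least two elements and q uses only one
   nullary symbol P, another nullary symbol P' being never entailed. Embedded
   dependencies are preserved under direct products. If they defined O, then
   {R(a), R(b)} would have a model I (in which P' fails), and {R(a)} a model J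
   in which P fails. Mapping a to (a, a) and b to (b, a) puts a copy of
   {R(a), R(b)} in the product of I and J, where P fails: a contradiction.
   As instances only contain constants from C, the product is cut down to a
   countable part, closed under witnesses for the dependencies, whose pairs are
   coded by constants. *)
Require Import Defs.
From mathcomp Require Import all_boot.
From mathcomp Require Import boolp classical_sets functions cardinality.
Local Open Scope classical_set_scope.

(** * Atoms under maps, and blocks of quantifiers *)

Lemma map_ratom_comp {T U V : Type} (f : U -> V) (g : T -> U) (a : ratom T) :
  map_ratom f (map_ratom g a) = map_ratom (f \o g) a.
Proof.
congr (RAtom _); apply: val_inj => /=; exact/esym/map_comp.
Qed.

Lemma eq_in_map_ratom {T : eqType} {U : Type} {f g : T -> U} {a : ratom T} :
  {in tval (rargs a), f =1 g} -> map_ratom f a = map_ratom g a.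
Proof.
move=> fg; congr (RAtom _); apply: val_inj => /=; exact/eq_in_map.
Qed.

Lemma map_nullary {T U : Type} (f : T -> U) (k : nat) :
  map_ratom f (@RAtom T (k, 0) [tuple]) = @RAtom U (k, 0) [tuple].
Proof. by congr RAtom; apply: val_inj. Qed.

Lemma sat_all_vars {C : choiceType} (I : instance C) (xs : seq var) f v :
  sat I v (all_vars xs f) <->
  forall w, {in xs, forall x, adom I (w x)} ->
    (forall x, x \notin xs -> w x = v x) -> sat I w f.
Proof.
elim: xs v => [|x xs IH] v /=.
  split=> [vf w _ wv|]; last by apply.
  by have -> : w = v by apply/funext => x; exact: wv.
split=> [vf w w_adom wv|vf c c_adom].
  have /IH := vf _ (w_adom x (mem_head x xs)); apply=> y.
    by move=> y_xs; apply: w_adom; rewrite inE y_xs orbT.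
  rewrite /update => y_xs; case: eqVneq => [->//|yx].
  by apply: wv; rewrite inE negb_or yx.
apply/IH => w w_adom wv; apply: vf => y.
  (* If [x] recurs in [xs], the inner binding wins, so membership in [xs] is tested first. *)
  rewrite inE; have [/w_adom//|y_xs] := boolP (y \in xs).
  by rewrite orbF => /eqP yx; rewrite wv // /update yx eqxx.
rewrite inE negb_or => /andP[yx y_xs].
by rewrite wv // /update (negPf yx).
Qed.

Lemma sat_ex_vars {C : choiceType} (I : instance C) (zs : seq var) f v :
  sat I v (ex_vars zs f) <->
  exists w, [/\ {in zs, forall z, adom I (w z)},
                forall z, z \notin zs -> w z = v z & sat I w f].
Proof.
elim: zs v => [|z zs IH] v /=.
  split=> [vf|[w [_ wv]]]; first by exists v.
  by have -> : w = v by apply/funext => x; exact: wv.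
split=> [[c c_adom /IH[w [w_adom wv wf]]]|[w [w_adom wv wf]]].
  exists w; split=> // y; rewrite inE.
    have [/w_adom//|y_zs] := boolP (y \in zs).
    by rewrite orbF => /eqP yz; rewrite wv // /update yz eqxx.
  rewrite negb_or => /andP[yz y_zs].
  by rewrite wv // /update (negPf yz).
exists (w z); first exact/w_adom/mem_head.
apply/IH; exists w; split=> // y.
  by move=> y_zs; apply: w_adom; rewrite inE y_zs orbT.
rewrite /update => y_zs; case: eqVneq => [->//|yz].
by apply: wv; rewrite inE negb_or yz.
Qed.

(** * Encoded parts of a direct product *)

Definition head_conj (C : choiceType) (psi : seq head_atom) : formula C :=
  big_and (map (@head_formula C) psi).

Definition subproduct {C : choiceType} (K : set C) (p : C -> C * C)
    (I J : instance C) : instance C :=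
  [set a | [/\ {in tval (rargs a), forall c, K c},
               I (map_ratom (fst \o p) a) & J (map_ratom (snd \o p) a)]].

Lemma adom_map {T : eqType} {C : choiceType} {I : instance C} {f : T -> C}
    {a c} :
  I (map_ratom f a) -> c \in tval (rargs a) -> adom I (f c).
Proof. by move=> Ia ca; exists (map_ratom f a) => //; exact: map_f. Qed.

(* The product is encoded with carrier K, the element c standing for the pair p c.
   The assignments u and u' take their values in pairs. *)
Definition skolem_closed {C : choiceType} (K : set C) (p : C -> C * C)
    (I J : instance C) (xs zs : seq var) (psi : seq head_atom) : Prop :=
  forall (w : var -> C) (u : var -> C * C),
    {in xs, forall x, K (w x)} -> {in xs, forall x, u x = p (w x)} ->
    sat I (fst \o u) (head_conj C psi) -> sat J (snd \o u) (head_conj C psi) ->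
  exists (w' : var -> C) (u' : var -> C * C),
    [/\ {in xs, forall x, w' x = w x}, {in zs, forall z, K (w' z)},
        {in xs ++ zs, forall x, u' x = p (w' x)},
        sat I (fst \o u') (head_conj C psi)
      & sat J (snd \o u') (head_conj C psi)].

Section Subproduct.
Context {C : choiceType} (K : set C) (p : C -> C * C) (I J : instance C).
Hypothesis p_inj : {in K &, injective p}.
Let N := subproduct K p I J.

Lemma adom_subproduct c :
  adom N c -> [/\ K c, adom I (p c).1 & adom J (p c).2].
Proof.
case=> a [aK aI aJ] ca.
by split; [exact: aK|exact: (adom_map aI)|exact: (adom_map aJ)].
Qed.

Lemma subproduct_body (phi : seq (ratom var)) w :
  sat N w (big_and (map (@body_formula C) phi)) ->
  sat I (fst \o p \o w) (big_and (map (@body_formula C) phi)) /\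
  sat J (snd \o p \o w) (big_and (map (@body_formula C) phi)).
Proof.
elim: phi => //= a phi IH [[_ aI aJ] /IH[phiI phiJ]].
by move: aI aJ; rewrite !map_ratom_comp.
Qed.

(* A witness that occurs in no fact of the product is constrained by equalities
   only, so that all such witnesses may be replaced by the same element e. *)
Lemma subproduct_head (psi : seq head_atom) (e : C) (w v : var -> C)
    (u : var -> C * C) :
  {in flatten (map head_atom_vars psi), forall x,
    [/\ K (w x), u x = p (w x)
      & v x = if pselect (adom N (w x)) then w x else e]} ->
  sat I (fst \o u) (head_conj C psi) -> sat J (snd \o u) (head_conj C psi) ->
  sat N v (head_conj C psi).
Proof.
elim: psi => //= a psi IH wuv [aI psiI] [aJ psiJ]; split; last first.
  by apply: IH => // x xpsi; apply: wuv; rewrite mem_cat xpsi orbT.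
have {}wuv : {in head_atom_vars a, forall x,
    [/\ K (w x), u x = p (w x)
      & v x = if pselect (adom N (w x)) then w x else e]}.
  by move=> x xa; apply: wuv; rewrite mem_cat xa.
case: a => [r|[x y]] /= in aI aJ wuv *; last first.
  have [Kx ux ->] := wuv x (mem_head _ _).
  have [|Ky uy ->] := wuv y; first by rewrite !inE eqxx orbT.
  suff -> : w x = w y by [].
  apply: p_inj; rewrite ?in_setE // -ux -uy.
  by rewrite [u x]surjective_pairing [u y]surjective_pairing; congr pair.
have Nr : N (map_ratom w r).
  split=> [_ /mapP[x xr ->]||]; first by have [] := wuv x xr.
    rewrite map_ratom_comp; move: aI; rewrite map_ratom_comp.
    by congr (I _); apply: eq_in_map_ratom => x /wuv[_ /= ->].
  rewrite map_ratom_comp; move: aJ; rewrite map_ratom_comp.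
  by congr (J _); apply: eq_in_map_ratom => x /wuv[_ /= ->].
rewrite map_ratom_comp (eq_in_map_ratom (g := w)) // => x xr /=.
have [_ _ ->] := wuv x xr.
by case: pselect => // -[]; exact: (adom_map Nr xr).
Qed.

(** A match of the body projects to both factors, each factor supplies witnesses for the head, and
    Skolem closure moves the pairs of witnesses into the image of [K]. As quantifiers range over the
    active domain, a witness outside it is replaced by [e]. *)
Lemma subproduct_ed (xs ys zs : seq var) (phi : seq (ratom var))
    (psi : seq head_atom) (e : C) :
  let f := all_vars xs (all_vars ys
             (FImp (big_and (map (@body_formula C) phi))
                   (ex_vars zs (head_conj C psi)))) in
  uniq (xs ++ ys ++ zs) -> {subset flatten (map head_atom_vars psi) <= xs ++ zs} ->
  adom N e -> skolem_closed K p I J xs zs psi ->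
  models I f -> models J f -> models N f.
Proof.
move=> f uniq_vars psi_vars e_adom skolem If Jf v.
apply/sat_all_vars => w0 w0_adom _; apply/sat_all_vars => w w_adom ww0 phiN.
have xs_ys x : x \in xs -> x \notin ys.
  move: uniq_vars; rewrite cat_uniq => /and3P[_ /hasPn dis _].
  by apply: contraL => xys; apply: dis; rewrite mem_cat xys.
have xs_zs x : x \in xs -> x \notin zs.
  move: uniq_vars; rewrite cat_uniq => /and3P[_ /hasPn dis _].
  by apply: contraL => xzs; apply: dis; rewrite mem_cat xzs orbT.
have xs_adom : {in xs, forall x, adom N (w x)}.
  by move=> x xxs; rewrite ww0 ?xs_ys//; exact: w0_adom.
have [phiI phiJ] := subproduct_body phi w phiN.
(* In a factor [L], the dependency is applied to the projected assignment; the witnesses change it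
   on [zs] only. *)
have factor (L : instance C) (g : C * C -> C) :
    {in xs ++ ys, forall x, adom L (g (p (w x)))} -> models L f ->
    sat L (g \o p \o w) (big_and (map (@body_formula C) phi)) ->
    exists u, [/\ forall x, x \notin zs -> u x = g (p (w x))
                & sat L u (head_conj C psi)].
  move=> L_adom Lf phiL.
  have /sat_all_vars/(_ (g \o p \o w)) := Lf (g \o p \o w).
  case/(_ _ _)/sat_all_vars/(_ (g \o p \o w))/(_ _ _ phiL)/sat_ex_vars => //.
  - by move=> x xxs; apply: L_adom; rewrite mem_cat xxs.
  - by move=> x xys; apply: L_adom; rewrite mem_cat xys orbT.
  - by move=> u [_ uw psiL]; exists u; split.
have vars_adom : {in xs ++ ys, forall x, adom N (w x)}.
  by move=> x; rewrite mem_cat => /orP[/xs_adom|/w_adom].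
have [|u1 [u1w psiI]] := factor I fst _ If phiI.
  by move=> x /vars_adom /adom_subproduct[].
have [|u2 [u2w psiJ]] := factor J snd _ Jf phiJ.
  by move=> x /vars_adom /adom_subproduct[].
(* The paired witnesses need not be coded in [K]; closure exchanges them for pairs that are. *)
have [||w' [u [w'w w'K uw' {}psiI {}psiJ]]] :=
    skolem w (fun x => (u1 x, u2 x)) _ _ psiI psiJ.
- by move=> x /xs_adom /adom_subproduct[].
- by move=> x /xs_zs xzs; rewrite u1w // u2w // -surjective_pairing.
apply/sat_ex_vars.
exists (fun x => if x \in zs then if pselect (adom N (w' x)) then w' x else e
                 else w x).
split=> [z ->|z /negPf ->//|].
  by case: pselect.
apply: (subproduct_head psi e w' _ u) => // x /psi_vars xpsi; split.
- move: xpsi; rewrite mem_cat => /orP[xxs|/w'K//].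
  by rewrite w'w //; have /adom_subproduct[] := xs_adom x xxs.
- exact: uw'.
- move: xpsi; rewrite mem_cat => /orP[xxs|->//].
  rewrite w'w // (negPf (xs_zs x xxs)).
  by case: pselect => // -[]; exact: xs_adom.
Qed.

End Subproduct.

(** * Countable Skolem closure *)

(* The numbering enum of the closure of {x0, x1} under the F k is made injective
   by keeping only the least index of each element. *)
Lemma countable_closure {C : choiceType} {T : Type} (i : nat -> C) (x0 x1 : T)
    (F : nat -> seq T -> T) :
  injective i -> x0 <> x1 ->
  exists (K : set C) (p : C -> T),
    [/\ {in K &, injective p},
        K (i 0) /\ p (i 0) = x0,
        K (i 1) /\ p (i 1) = x1
      & forall k l, {in l, forall c, K c} ->
          exists2 c, K c & p c = F k (map p l)].
Proof.
move=> i_inj x01.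
(* Trees serve as terms over the operations [F k]; being countable, they enumerate the closure. *)
pose ev := fix ev (t : GenTree.tree nat) : T :=
  match t with
  | GenTree.Leaf n => if n is 0 then x0 else x1
  | GenTree.Node k ts => F k (map ev ts)
  end.
(* Indices 0 and 1 are reserved, so that [i 0] and [i 1] code [x0] and [x1]; index 1 is least for
   [x1] because [x0 <> x1]. *)
pose enum n := match n with 0 => x0 | 1 => x1
  | m.+2 => if unpickle m is Some t then ev t else x0 end.
have ev_enum t : exists n, enum n = ev t.
  by exists (pickle t).+2; rewrite /= pickleK.
have enum_ev n : exists t, ev t = enum n.
  case: n => [|[|m]] /=.
  - by exists (GenTree.Leaf 0).
  - by exists (GenTree.Leaf 1).
  - by case: unpickle => [t|]; [exists t|exists (GenTree.Leaf 0)].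
pose K := [set c | exists2 n, c = i n & forall m, m < n -> enum m <> enum n].
have /choice[p pE] : forall c, exists t, forall n, c = i n -> t = enum n.
  move=> c; have [[n ->]|no] := pselect (exists n, c = i n).
    by exists (enum n) => m /i_inj ->.
  by exists x0 => n cn; case: no; exists n.
have least n : exists2 c, K c & p c = enum n.
  have ex : exists m, `[< enum m = enum n >] by exists n; exact/asboolP.
  case: (ex_minnP ex) => m /asboolP mn m_min.
  exists (i m); last by rewrite (pE _ m).
  exists m => // k km kn; have /m_min : `[< enum k = enum n >].
    by apply/asboolP; rewrite kn.
  by rewrite leqNgt km.
exists K, p; split.
- move=> _ _ /set_mem[n -> n_min] /set_mem[m -> m_min].
  rewrite (pE _ n) // (pE _ m) // => nm.
  have [mn|nm'|->//] := ltngtP m n; first by case: (n_min m).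
  by case: (m_min n).
- by split; [exists 0|rewrite (pE _ 0)].
- by split; [exists 1 => // -[|//] _|rewrite (pE _ 1)].
- move=> k l lK.
  (* Elements of [K] decode to values of trees, which become the children of a single node labelled
     [k]. *)
  have [ts ->] : exists ts, map p l = map ev ts.
    elim: l lK => [|c l IH] lK; first by exists [::].
    have [|ts /= ->] := IH.
      by move=> d dl; apply: lK; rewrite inE dl orbT.
    have [n -> _] := lK c (mem_head _ _).
    by have [t tn] := enum_ev n; exists (t :: ts); rewrite /= tn (pE _ n).
  have [n en] := ev_enum (GenTree.Node k ts).
  by have [c Kc pc] := least n; exists c; rewrite // pc en.
Qed.

(** Skolem closure involves only [xs], [zs] and [psi], so these alone are numbered. Indices that no
    dependency receives get empty data. *)
Lemma ed_enumeration {C : choiceType} (R : schema)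
    (Sigma : set (formula C)) :
  countable Sigma -> (forall s, Sigma s -> is_ed R s) ->
  exists d : nat -> seq var * seq var * seq head_atom,
    forall s, Sigma s -> exists k ys phi,
      let: (xs, zs, psi) := d k in
      [/\ uniq (xs ++ ys ++ zs),
          {subset flatten (map head_atom_vars psi) <= xs ++ zs}
        & s = all_vars xs (all_vars ys
                (FImp (big_and (map (@body_formula C) phi))
                      (ex_vars zs (head_conj C psi))))].
Proof.
move=> /countable_injP[f f_inj] eds.
pose ok s (t : seq var * seq var * seq head_atom) := exists ys phi,
  let: (xs, zs, psi) := t in
  [/\ uniq (xs ++ ys ++ zs),
      {subset flatten (map head_atom_vars psi) <= xs ++ zs}
    & s = all_vars xs (all_vars ys
            (FImp (big_and (map (@body_formula C) phi))
                  (ex_vars zs (head_conj C psi))))].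
have /choice[d dP] : forall k, exists t, forall s,
    Sigma s -> f s = k -> ok s t.
  move=> k; have [[s [Ss <-]]|no] := pselect (exists s, Sigma s /\ f s = k).
    have [xs [ys [zs [phi [psi]]]]] := eds s Ss.
    move=> /= [uniq_vars _ [_ psi_vars] _ [_ sE]].
    exists (xs, zs, psi) => s' Ss' /f_inj ->; rewrite ?in_setE //.
    by exists ys, phi.
  by exists ([::], [::], [::]) => s Ss fs; case: no; exists s.
exists d => s Ss; have [ys [phi sE]] := dP _ s Ss erefl.
by exists (f s), ys, phi.
Qed.

(** Each dependency and variable give one operation, which sends the list of values of [xs] to a
    pair of witnesses. A set of pairs closed under these countably many operations is Skolem closed
    for every dependency. *)
Lemma countable_subproduct {C : choiceType} (R : schema)
    (Sigma : set (formula C)) (I J : instance C) (i : nat -> C) (x0 x1 : C * C) :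
  countable Sigma -> (forall s, Sigma s -> is_ed R s) ->
  (forall s, Sigma s -> models I s) -> (forall s, Sigma s -> models J s) ->
  injective i -> x0 <> x1 ->
  exists (K : set C) (p : C -> C * C),
    [/\ K (i 0) /\ p (i 0) = x0,
        K (i 1) /\ p (i 1) = x1
      & forall e, adom (subproduct K p I J) e ->
          forall s, Sigma s -> models (subproduct K p I J) s].
Proof.
move=> Sigma_countable eds modI modJ i_inj x01.
have [d dP] := ed_enumeration R Sigma Sigma_countable eds.
pose wit k l (u : var -> C * C) := let: (xs, zs, psi) := d k in
  [/\ map u xs = l, sat I (fst \o u) (head_conj C psi)
    & sat J (snd \o u) (head_conj C psi)].
(* [U (k, l)] depends only on [k] and [l], hence serves every assignment with values [l] on [xs]. *)
have /choice[U UP] : forall kl, exists u, forall u',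
    wit kl.1 kl.2 u' -> wit kl.1 kl.2 u.
  move=> [k l]; have [[u uP]|no] := pselect (exists u, wit k l u).
    by exists u.
  by exists (fun=> x0) => u' u'P; case: no; exists u'.
(* The number of an operation codes a dependency index and a variable. *)
pose F n l := if unpickle n is Some (k, z) then U (k, l) z else x0.
have [K [p [p_inj K0 K1 closed]]] := countable_closure i x0 x1 F i_inj x01.
exists K, p; split=> // e e_adom s Ss.
have [k [ys [phi]]] := dP s Ss.
case dk : (d k) => [[xs zs] psi] [uniq_vars psi_vars sE].
rewrite sE; apply: (subproduct_ed K p I J p_inj xs ys zs phi psi e) => //;
  rewrite -?sE; [|exact: modI|exact: modJ].
move=> w u wK uw psiI psiJ.
pose l := map w xs.
have lK : {in l, forall c, K c} by move=> _ /mapP[x xxs ->]; exact: wK.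
have : wit k (map p l) (U (k, map p l)).
  apply: (UP (k, map p l) u); rewrite /wit dk; split=> //.
  by rewrite -map_comp; apply/eq_in_map => x /uw.
rewrite /wit dk => -[u'xs u'I u'J].
have /choice[g gP] : forall z, exists c, K c /\ p c = U (k, map p l) z.
  move=> z; have [c Kc pc] := closed (pickle (k, z)) l lK.
  by exists c; rewrite pc /F pickleK.
(* Keeping [w] on [xs] is consistent, since [U (k, map p l)] was chosen to agree with [p \o w]
   there. *)
exists (fun x => if x \in xs then w x else g x), (U (k, map p l)).
split=> //.
- by move=> x ->.
- by move=> z _ /=; case: ifP => [/wK//|_]; have [] := gP z.
- move=> x _ /=; case: ifP => [xxs|_]; last by have [] := gP x.
  by move: u'xs; rewrite -map_comp => /eq_in_map/(_ x xxs).
Qed.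

(** * A disjunction property of entailment *)

Definition unary_fact {C : choiceType} (c : C) : ratom C :=
  @RAtom C (0, 1) [tuple c].

Definition nullary_query (C : choiceType) (k : nat) : bcq C :=
  @BCQ C [:: @RAtom (term C) (k, 0) [tuple]] isT.

(** The constant [c] supplies a valuation, so that [models] is not vacuous. *)
Lemma models_nullary {C : choiceType} (I : instance C) (k : nat) (c : C) :
  models I (bcq_formula (nullary_query C k)) <-> I (@RAtom C (k, 0) [tuple]).
Proof.
rewrite /models /bcq_formula /bcq_vars /=.
split=> [/(_ (fun=> c))[]|Ik v]; rewrite map_nullary //.
Qed.

(** Failure of the second alternative provides a model of [D2] and [Sigma], thus ruling out that
    [D2] entails the query merely by inconsistency. *)
Lemma entails_disjunction {C : choiceType} (R : schema) (Sigma : set (formula C))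
    (i : nat -> C) (k k' : nat) :
  injective i -> countable Sigma -> (forall s, Sigma s -> is_ed R s) ->
  let D1 := [set unary_fact (i 0)] in
  let D2 := [set unary_fact (i 0); unary_fact (i 1)] in
  entails R D2 Sigma (nullary_query C k) ->
  entails R D1 Sigma (nullary_query C k) \/ entails R D2 Sigma (nullary_query C k').
Proof.
move=> i_inj Sigma_countable eds D1 D2 D2k.
apply: contrapT => /not_orP[].
have entailsN D l : ~ entails R D Sigma (nullary_query C l) ->
    exists I, [/\ instance_over R I, D `<=` I, forall s, Sigma s -> models I s
      & ~ I (@RAtom C (l, 0) [tuple])].
  move=> nD; apply: contrapT => noI; apply: nD => I IR DI modI.
  apply/(models_nullary _ _ (i 0)); apply: contrapT => nI.
  by apply: noI; exists I.
move=> /entailsN[J [JR DJ modJ Jk]] /entailsN[I [IR DI modI _]].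
(* Both pairs have second component [i 0], the one element known to satisfy the unary symbol in [J];
   their first components keep them distinct. *)
have [|K [p [[K0 p0] [K1 p1] modN]]] :=
  countable_subproduct R Sigma I J i (i 0, i 0) (i 1, i 0)
    Sigma_countable eds modI modJ i_inj.
  by case=> /i_inj.
pose N := subproduct K p I J.
have unary_map (f : C -> C) c : map_ratom f (unary_fact c) = unary_fact (f c).
  by congr RAtom; apply: val_inj.
have N0 : N (unary_fact (i 0)).
  split; first by move=> c; rewrite mem_seq1 => /eqP ->.
    by rewrite unary_map /= p0; apply: DI; left.
  by rewrite unary_map /= p0; exact: DJ.
have N1 : N (unary_fact (i 1)).
  split; first by move=> c; rewrite mem_seq1 => /eqP ->.
    by rewrite unary_map /= p1; apply: DI; right.
  by rewrite unary_map /= p1; exact: DJ.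
have NR : instance_over R N by move=> a [_ /IR].
have ND : D2 `<=` N by move=> _ [] ->.
have N0_adom : adom N (i 0).
  by exists (unary_fact (i 0)); rewrite //= mem_seq1.
have := D2k N NR ND (modN _ N0_adom).
(* A nullary fact of the product holds in both factors, but this one fails in [J]. *)
move/(models_nullary _ _ (i 0)) => [_ _].
by rewrite map_nullary.
Qed.

(** * The two-element ontology *)

Section Ontology.
Context {C : choiceType}.

Definition unary_schema : schema := [set (0, 1)].
(** [(1, 0)] plays the role of P and [(2, 0)] that of P'. *)
Definition nullary_schema : schema := [set (1, 0); (2, 0)].
Let two_elements (D : instance C) :=
  exists c d, [/\ adom D c, adom D d & c <> d].
Let only_atom1 (q : bcq C) := all (fun a => rsym a == (1, 0)) (bcq_atoms q).

Definition two_element_ontology : set (instance C * bcq C) :=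
  [set x | [/\ admissible unary_schema nullary_schema x.1 x.2,
               two_elements x.1 & only_atom1 x.2]].

Lemma formula_over_bcq (S : schema) (q : bcq C) :
  bcq_over S q <-> all (fun a => `[< S (rsym a) >]) (bcq_atoms q).
Proof.
rewrite /bcq_over /bcq_formula.
have -> zs f : formula_over S (ex_vars zs f) = formula_over S (C := C) f.
  by elim: zs => //= z zs ->.
elim: bcq_atoms => //= a s IH; split.
  by case=> /asboolP -> /IH.
by case/andP => /asboolP Sa /IH.
Qed.

Lemma nullary_bcq {q : bcq C} : bcq_over nullary_schema q ->
  bcq_vars q = [::] /\ bcq_csts q = set0.
Proof.
move=> /formula_over_bcq; rewrite /bcq_vars /bcq_csts.
have nullary (a : ratom (term C)) : nullary_schema (rsym a) -> tval (rargs a) = [::].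
  case: a => r l rQ; have {}rQ : nullary_schema r := rQ.
  by case: rQ l => -> l; rewrite [l]tuple0.
suff sE s : all (fun a => `[< nullary_schema (rsym a) >]) s ->
    flatten (map (@atom_vars C) s) = [::] /\ flatten (map (@atom_csts C) s) = [::].
  by move=> /sE[-> ->]; split=> //; apply/seteqP; split.
elim: s => //= a s IH /andP[/asboolP/nullary a0 /IH[-> ->]].
by rewrite /atom_vars /atom_csts a0.
Qed.

(** Truth in the instance where exactly P holds expresses the syntactic condition semantically,
    which makes it closed under entailment of queries. *)
Lemma models_only_atom1 {q : bcq C} (c : C) : bcq_over nullary_schema q ->
  models [set a : ratom C | rsym a = (1, 0)] (bcq_formula q) <-> only_atom1 q.
Proof.
move=> /nullary_bcq[q0 _]; rewrite /models /bcq_formula q0 /only_atom1 /=.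
have sat_all v s :
    sat [set a : ratom C | rsym a = (1, 0)] v (big_and (map (@FRel C) s)) <->
    all (fun a => rsym a == (1, 0)) s.
  by elim: s => //= a s IH; split=> [[/= -> /IH]|/andP[/eqP ? /IH]].
by split=> [/(_ (fun=> c))/sat_all|/sat_all].
Qed.

Lemma two_element_ontology_ocqa (c : C) :
  ocqa_ontology unary_schema nullary_schema two_element_ontology.
Proof.
split=> [D q []//|D q q' [] [D_db qQ qD] D2 q1 [] [_ q'Q q'D] _ q'1
        |D q q' q'Q qq' []|D D' q D'_db].
- have qq'Q : bcq_over nullary_schema (bcq_and q q').
    move: qQ q'Q => /formula_over_bcq qQ /formula_over_bcq q'Q.
    apply/formula_over_bcq.
    by rewrite /= all_cat qQ all_map.
  split=> //; first by split=> //=; have [_ ->] := nullary_bcq qq'Q.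
  by rewrite /only_atom1 /= all_cat all_map /=; apply/andP; split.
- move=> [D_db qQ _] D2 q1; split=> //.
    by split=> //=; have [_ ->] := nullary_bcq q'Q.
  by apply/(models_only_atom1 c q'Q)/qq'/(models_only_atom1 c qQ).
- move=> [h [h_inj hD _ _]] [[D_db qQ _] [a [b [aD bD ab]]] q1]; split=> //.
    by split=> //=; have [_ ->] := nullary_bcq qQ.
  (* Injectivity of the embedding keeps the two elements distinct. *)
  exists (h a), (h b).
  split; [by apply: hD; exists a|by apply: hD; exists b|].
  by move=> /h_inj; rewrite !in_setE => /(_ aD bD).
Qed.

Lemma two_element_ontology_rewritable (c : C) :
  fo_rewritable unary_schema nullary_schema two_element_ontology.
Proof.
move=> q qQ; have [q1|q1] := boolP (only_atom1 q); last first.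
  (* A query mentioning P' belongs to no pair; for the others, the rewriting states that two
     distinct elements exist. *)
  exists FFalse; split=> // D D_db qD; split=> [[_ _]|/(_ (fun=> c))//].
  by rewrite (negPf q1).
exists (FEx 0 (FEx 1 (FNot (FEq (Var 0) (Var 1))))); split=> // D D_db qD.
split=> [[_ [a [b [aD bD ab]]] _ v]|/(_ (fun=> c))/= [a aD [b bD ab]]].
  by exists a => //; exists b.
by split=> //; exists a, b.
Qed.

End Ontology.

(** * Undefinability by embedded dependencies *)

Theorem proposition10 (C : choiceType) (Cinf : infinite_set [set: C]) :
  exists (DS QS : schema) (O : set (instance C * bcq C)),
    [/\ finite_set DS /\ finite_set QS,
        ocqa_ontology DS QS O,
        fo_rewritable DS QS O
      & ~ exists (R : schema) (Sigma : set (formula C)),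
            [/\ DS `|` QS `<=` R,
                finite_set Sigma,
                forall s, Sigma s -> is_ed R s
              & O = Sem R Sigma DS QS]].
Proof.
have [i i_inj] : exists i : nat -> C, injective i.
  move/infiniteP/card_leP: Cinf => [f].
  exists (fun n => val (f (exist _ n (mem_setT n)))) => m n /val_inj mn.
  have := 'inj_f (mem_setT _) (mem_setT _) mn.
  by move=> /(congr1 val).
exists unary_schema, nullary_schema, two_element_ontology; split.
- by split; [exact: finite_set1|rewrite finite_setU; split; exact: finite_set1].
- exact: two_element_ontology_ocqa (i 0).
- exact: two_element_ontology_rewritable (i 0).
move=> [R [Sigma [_ Sigma_finite eds OE]]].
pose D1 := [set unary_fact (i 0)].
pose D2 := [set unary_fact (i 0); unary_fact (i 1)].
have adm D k : D `<=` D2 -> nullary_schema (k, 0) ->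
    admissible unary_schema nullary_schema D (nullary_query C k).
  move=> DD2 kQ.
  have kQ' : bcq_over nullary_schema (nullary_query C k).
    by apply/formula_over_bcq; rewrite /= andbT; exact/asboolP.
  split=> //; split; first by move=> a /DD2[] ->.
  apply: sub_finite_set DD2 _.
  by rewrite finite_setU; split; exact: finite_set1.
have adom_fact D c : D (unary_fact c) -> adom D c.
  by exists (unary_fact c); rewrite //= mem_seq1.
have D2k : entails R D2 Sigma (nullary_query C 1).
  suff : two_element_ontology (D2, nullary_query C 1) by rewrite OE => -[].
  split=> //; first by apply: adm => //; left.
  exists (i 0), (i 1).
  split; [by apply: adom_fact; left|by apply: adom_fact; right|].
  by move=> /i_inj.
(* Both alternatives contradict the ontology: [D1] has a single element, and P' is never
   entailed. *)
have [D1k|D2k'] := entails_disjunction R Sigma i 1 2 i_inj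
  (finite_set_countable Sigma_finite) eds D2k.
  have : two_element_ontology (D1, nullary_query C 1).
    by rewrite OE; split=> //; apply: adm; [left|left].
  have D1_adom c : adom D1 c -> c = i 0.
    by move=> [_ -> /=]; rewrite mem_seq1 => /eqP.
  by move=> [_ [a [b [/D1_adom -> /D1_adom ->]]]].
have : two_element_ontology (D2, nullary_query C 2).
  by rewrite OE; split=> //; apply: adm => //; right.
by case.
Qed.
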